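(* There are universal constants $c,c'\in(0,\infty)$ with the following property. Suppose that $\omega,\Omega:[0,\infty)\to[0,\infty)$ are increasing functions that satisfy $\omega(s)\le\Omega(s)$ for all $s\in[0,\infty)$, as well as $\lim_{s\to\infty}\omega(s)=\infty$. Define $$\beta(\omega,\Omega)=\sup_{s\in(0,\infty)}\frac{s}{\omega^{-1}(2\Omega(s))}.$$ Then for arbitrarily large $n\in\mathbb N$ there is a metric space $(\mathcal M,d_{\mathcal M})$ (depending on $n,\omega,\Omega$) with $|\mathcal M|=3n$ such that for any normed space $(X,\|\cdot\|_X)$, if there exists $f:\mathcal M\to X$ which satisfies $$\forall\,x,y\in\mathcal M,\qquad \omega\big(d_{\mathcal M}(x,y)\big)\le\|f(x)-f(y)\|_X\le\Omega\big(d_{\mathcal M}(x,y)\big),$$ then necessarily $$\dim(X)\ge c'\,n^{c\beta(\omega,\Omega)}.$$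
   Context: All normed spaces are over $\mathbb R$. For $t\ge 0$ with $t\ge\omega(0)$, $\omega^{-1}(t)$ denotes the (generalized) inverse $\omega^{-1}(t)=\sup\{u\ge 0:\ \omega(u)\le t\}$, which is the usual inverse when $\omega$ is a bijection of $[0,\infty)$. ''For arbitrarily large $n$'' means for infinitely many $n\in\mathbb N$. *)

(* Defs.v *)
From mathcomp Require Import all_boot all_order all_algebra.
From mathcomp Require Import all_classical all_reals all_analysis.
Set Implicit Arguments.
Unset Strict Implicit.
Unset Printing Implicit Defensive.
Import Order.TTheory GRing.Theory Num.Theory.
Import numFieldNormedType.Exports.
Local Open Scope classical_set_scope.
Local Open Scope ring_scope.

(* A function [0, oo) -> [0, oo) is represented by a function R -> R of which
   only the restriction to [0, oo) is ever used. *)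
Definition nonneg_fun (R : realType) (w : R -> R) :=
  forall s, 0 <= s -> 0 <= w s.

(* "Increasing" in the weak sense, hence the generalized inverse below. *)
Definition increasing_on_nonneg (R : realType) (w : R -> R) :=
  forall s t, 0 <= s -> s <= t -> w s <= w t.

(* The set is nonempty when w 0 <= t, and bounded when w tends to +oo, so that
   the real-valued [sup] (0 by convention otherwise) is then a true supremum. *)
Definition gen_inv (R : realType) (w : R -> R) (t : R) : R :=
  sup [set u | 0 <= u /\ w u <= t].

(* If w <= W, then s <= gen_inv w (2 * W s), so that the ratios lie in ]0, 1]
   and the real-valued [sup] is again a true supremum. *)
Definition beta (R : realType) (w W : R -> R) : R :=
  sup [set s / gen_inv w (2 * W s) | s in [set s | 0 < s]].

Definition lin_indep (R : realType) (V : lmodType R) (n : nat)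
    (v : 'I_n -> V) :=
  forall a : 'I_n -> R, \sum_(i < n) a i *: v i = 0 -> forall i, a i = 0.

(* The dimension of an arbitrary real vector space, +oo when it is infinite. *)
Definition ldim (R : realType) (V : lmodType R) : \bar R :=
  ereal_sup [set (n%:R)%:E | n in
              [set n : nat | exists v : 'I_n -> V, lin_indep v]].

Lemma ldim_vectType (R : realType) (V : vectType R) :
  ldim V = ((\dim {:V})%:R)%:E.
Proof.
apply/eqP; rewrite eq_le; apply/andP; split.
- apply: ge_ereal_sup => _ [n [v vfree] <-]; rewrite lee_fin ler_nat.
  have vf : free [tuple v i | i < n].
    apply/freeP => k kv i; apply: vfree; rewrite -[RHS]kv.
    by apply: eq_bigr => j _; rewrite -tnth_nth tnth_mktuple.
  have := dimvS (subvf <<[tuple v i | i < n]>>%VS).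
  by rewrite (eqP vf) size_tuple.
- apply: ereal_sup_ubound; exists (\dim {:V}) => //=.
  exists (fun i => (vbasis {:V})`_i) => a av0.
  by have /freeP := basis_free (vbasisP {:V}); apply.
Qed.

(* Main.v *)
From HB Require Import structures.
Require Import Defs.
From mathcomp Require Import all_boot all_order all_algebra.
From mathcomp Require Import all_classical all_reals all_analysis.
From mathcomp Require Import zify ring lra.
Import Order.TTheory GRing.Theory Num.Theory.
Import numFieldNormedType.Exports.
Set Implicit Arguments.
Unset Strict Implicit.
Unset Printing Implicit Defensive.

(** The proof is a counting argument: there are many more candidate spaces [M]
    than there are low-dimensional geometries that could contain one of them.

    Fix a bipartite graph [E] between [x_1 .. x_n] and [1 .. n], double each
    right vertex [j] into two points [y_j] and [z_j], and for each edge [(i, j)]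
    join [x_i] either to [y_j] or to [z_j], according to whether [(i, j)] lies
    in a set [S] of edges.  This gives [2 ^ #|E|] graphs on [3n] points.  If [E]
    has no short cycles, a walk from [y_j] to [z_j] is long in all of them; the
    greedy choice of [E] in [dense_separating] makes it at least [g = k + 1],
    while [E] keeps about [n * n ^ (c / g)] edges.  The metric is [s] times the
    graph distance truncated at [g].  The value of [beta] provides [s] and
    [g = O(1 / beta)] such that [2 * Omega s < omega (g * s)] ([beta_witness]).

    In an embedding, [x_i] is then at distance at most [Omega s] from one of
    [y_j], [z_j], whose mutual distance is more than [2 * Omega s].  A norming
    functional [q_j] of [y_j - z_j] thus has
    [q_j (x_i) - (q_j (y_j) + q_j (z_j)) / 2] positive or negative according to
    [S].  These numbers form a matrix of rank at most [dim X + 1] that has the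
    sign pattern [S] on [E] ([sign_matrix]).

    It remains to find a pattern [S] that no matrix of rank at most [t] has.
    The integer [n] may depend on [omega] and [Omega], whereas the size of the
    entries and their distance to 0 do not depend on [n].  So rounding preserves
    the signs: a matrix of rank at most [t] with entries in [[-1, 1]] is a
    product of two matrices with [n * t] entries in [[-1, 1]] each
    ([bounded_rank_factorization], from a minor of maximal absolute value), and
    these entries can be replaced by nearby points of a grid.  This leaves at most
    [2 ^ (2 * n * t ^ 2)] patterns ([unrealizable_pattern]), fewer than
    [2 ^ #|E|] when the vertices of [E] have degrees about [4 * t ^ 2]; for
    this, [n] of order [(4 * t ^ 2) ^ g] is enough, hence
    [t >= n ^ (1 / (4 * g))]. *)

(** * Walks of bounded length *)

Local Open Scope nat_scope.

Section Walks.
Variables (T : finType) (e : rel T).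

(** A step may stay in place, so that [within l] means a walk of length at most
    [l]. *)
Fixpoint within (l : nat) (x y : T) : bool :=
  if l is l'.+1 then [exists z, ((z == x) || e x z) && within l' z y]
  else x == y.

Lemma within_refl l x : within l x x.
Proof.
by elim: l => //= l IH; apply/existsP; exists x; rewrite eqxx.
Qed.

Lemma within1 x y : e x y -> within 1 x y.
Proof. by move=> exy; apply/existsP; exists y; rewrite exy orbT /=. Qed.

Lemma within_cat a b x y z : within a x y -> within b y z -> within (a + b) x z.
Proof.
elim: a x => [|a IH] x /=; first by move/eqP->.
by case/existsP=> w /andP[xw /IH wy] /wy ?; apply/existsP; exists w; rewrite xw.
Qed.

Lemma within_leq a b x y : a <= b -> within a x y -> within b x y.
Proof.
by move=> /subnKC <- xy; apply: within_cat xy _; apply: within_refl.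
Qed.

Lemma within_sym l x y : symmetric e -> within l x y = within l y x.
Proof.
move=> e_sym; suff {x y} sub x y : within l x y -> within l y x.
  by apply/idP/idP; apply: sub.
elim: l x y => [|l IH] x y /=; first by rewrite eq_sym.
case/existsP=> z /andP[xz /IH yz].
suff: within (l + 1) y x by rewrite addn1.
apply: within_cat yz _; case/predU1P: xz => [->|xz]; first exact: within_refl.
by apply: within1; rewrite e_sym.
Qed.

Lemma card_within d l x : (forall y, #|e y| <= d) -> #|within l x| <= d.+1 ^ l.
Proof.
move=> degd; elim: l x => [|l IH] x /=.
  rewrite expn0 (eq_card (B := pred1 x)) ?card1 // => y.
  by rewrite !inE unfold_in /= eq_sym.
apply: (leq_trans (n := \sum_(z in predU1 x (e x)) d.+1 ^ l)).
  apply: (leq_trans (n := \sum_(z in predU1 x (e x)) #|within l z|)); last first.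
    by apply: leq_sum => z _; apply: IH.
  under [leqRHS]eq_bigr do rewrite -sum1_card.
  rewrite -sum1_card (exchange_big_dep predT) //= [leqRHS]big_mkcond /=.
  rewrite big_mkcond; apply: leq_sum => y _; case: ifP => //.
  case/existsP=> z /andP[xz zy].
  by rewrite (bigD1 z) //=; apply/andP; split; rewrite ?inE.
rewrite sum_nat_const expnS leq_mul2r; apply/orP; right.
by rewrite cardU1 -add1n leq_add // leq_b1.
Qed.
End Walks.

Lemma within_homo (T T' : finType) (e : rel T) (e' : rel T') (h : T -> T') l x y :
    (forall u v, e u v -> e' (h u) (h v)) ->
  within e l x y -> within e' l (h x) (h y).
Proof.
move=> hE; elim: l x => [|l IH] x /=; first by move/eqP->.
case/existsP=> z /andP[xz /IH zy]; apply/existsP; exists (h z).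
by rewrite zy andbT; case/predU1P: xz => [->|/hE ->]; rewrite ?eqxx ?orbT.
Qed.

(** Cut a walk that uses the new edge before its first and after its last
    passage through it.  The two old walks that remain either end and start at
    the two ends of the edge, or at the same end and then join up. *)
Lemma within_insert (T : finType) (e e' : rel T) a b l x y :
    (forall u v, e' u v ->
      [\/ e u v, u = a /\ v = b | u = b /\ v = a]) ->
  within e' l x y ->
  within e l x y \/ exists l1 l2, l1 + l2 < l /\
    (within e l1 x a /\ within e l2 b y \/ within e l1 x b /\ within e l2 a y).
Proof.
move=> e'E; elim: l x => [|l IH] x /=; first by left.
case/existsP=> z /andP[xz /IH{IH} zy].
have keep : (z == x) || e x z -> within e l.+1 x y \/
    exists l1 l2, l1 + l2 < l.+1 /\
    (within e l1 x a /\ within e l2 b y \/ within e l1 x b /\ within e l2 a y).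
  move=> step; case: zy => [zy|[l1 [l2 [lt12 w12]]]].
    by left; apply/existsP; exists z; rewrite step.
  right; exists l1.+1, l2; split=> //.
  have st w : within e l1 z w -> within e l1.+1 x w.
    by move=> ?; apply/existsP; exists z; rewrite step.
  by case: w12 => -[/st ? ?]; [left | right].
case/predU1P: xz => [zx|]; first by apply: keep; rewrite zx eqxx.
case/e'E=> [xz|[-> zb]|[-> za]]; first by apply: keep; rewrite xz orbT.
- rewrite {}zb in zy; case: zy => [by_|[l1 [l2 [lt12 [[_ w2]|[_ w2]]]]]].
  + by right; exists 0, l; split=> //; left; split=> //; apply: within_refl.
  + right; exists 0, l2; split; first lia.
    by left; split=> //; apply: within_refl.
  + by left; apply: (@within_leq _ e l2 l.+1) w2; lia.
- rewrite {}za in zy; case: zy => [ay|[l1 [l2 [lt12 [[_ w2]|[_ w2]]]]]].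
  + by right; exists 0, l; split=> //; right; split=> //; apply: within_refl.
  + by left; apply: (@within_leq _ e l2 l.+1) w2; lia.
  + right; exists 0, l2; split; first lia.
    by right; split=> //; apply: within_refl.
Qed.

(** * Dense bipartite graphs whose lifts keep the two copies apart *)

Section Lifts.
Variable n : nat.
Implicit Types (E S : {set 'I_n * 'I_n}) (u w : 'I_n).

Definition bip E : rel ('I_n + 'I_n) := fun p q =>
  match p, q with
  | inl u, inr w | inr w, inl u => (u, w) \in E
  | _, _ => false
  end.

(** The left vertices are kept, each right vertex [w] becomes the two vertices
    [(w, true)] and [(w, false)], and [S] says which of the two an edge of [E]
    is attached to. *)
Definition lift2 E S : rel ('I_n + 'I_n * bool) := fun p q =>
  match p, q with
  | inl u, inr wb | inr wb, inl u =>
      ((u, wb.1) \in E) && (((u, wb.1) \in S) == wb.2)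
  | _, _ => false
  end.

Definition forget_sign (p : 'I_n + 'I_n * bool) : 'I_n + 'I_n :=
  match p with inl u => inl u | inr wb => inr wb.1 end.

Lemma bip_sym E : symmetric (bip E).
Proof. by case=> u [] w. Qed.

Lemma lift2_sym E S : symmetric (lift2 E S).
Proof. by case=> u [] w. Qed.

Lemma within_forget_sign E S l p q :
  within (lift2 E S) l p q -> within (bip E) l (forget_sign p) (forget_sign q).
Proof.
by apply: within_homo => -[u|wb] [u'|wb'] //= /andP[].
Qed.

(** This holds as soon as [E] has no cycle of length at most [k], since a
    shortest walk between the copies of [w] projects to a closed walk without
    backtracking.  Unlike the girth, it involves no cycles, so that the effect of
    a new edge can be read off [within_insert]. *)
Definition separating k E : bool :=
  [forall S : {set 'I_n * 'I_n}, forall w,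
     ~~ within (lift2 E S) k (inr (w, true)) (inr (w, false))].

Lemma separatingP k E :
  reflect (forall S w, ~~ within (lift2 E S) k (inr (w, true)) (inr (w, false)))
          (separating k E).
Proof.
by apply: (iffP forallP) => [H S|H S]; [apply/forallP/H | apply/forallP/H].
Qed.

Lemma separating0 k : separating k finset.set0.
Proof.
apply/separatingP => S w; elim: k => [|k IH] /=; first by apply/eqP; case.
apply/existsP=> -[z /andP[/predU1P[->|wz] ]]; first exact/negP.
by case: z wz => //= u; rewrite inE.
Qed.

(** A short walk between the copies of [i] that uses the new edge projects to
    old walks from [i] to [u] and from [w] to [i] (or conversely), and these join
    [u] to [w] in at most [k] steps. *)
Lemma separating_insert k E u w :
  separating k E -> ~~ within (bip E) k (inl u) (inr w) ->
  separating k ((u, w) |: E).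
Proof.
move=> /separatingP sepE far; apply/separatingP => S i; apply/negP => walk.
pose b := (u, w) \in S.
have ins p q : lift2 ((u, w) |: E) S p q ->
    [\/ lift2 E S p q, p = inl u /\ q = inr (w, b) | p = inr (w, b) /\ q = inl u].
  have new u' (wb : 'I_n * bool) :
      ((u', wb.1) \in (u, w) |: E) && (((u', wb.1) \in S) == wb.2) ->
      ((u', wb.1) \in E) && (((u', wb.1) \in S) == wb.2) \/ u' = u /\ wb = (w, b).
    case: wb => w' b' /= /andP[/finset.setU1P[[-> ->] /eqP <-|->]]; first by right.
    by left.
  case: p q => [u'|wb] [u''|wb'] //=.
    by case/new=> [|[-> ->]]; [constructor 1 | constructor 2].
  by case/new=> [|[-> ->]]; [constructor 1 | constructor 3].
case: (within_insert ins walk) => [walk'|[l1 [l2 [lt12 w12]]]].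
  by have /negP := sepE S i.
have /negP[] := far.
case: w12 => -[/within_forget_sign /= W1 /within_forget_sign /= W2].
  apply: (@within_leq _ _ (l1 + l2)); first lia.
  by apply: within_cat (inr i) _ _ _; rewrite within_sym //; apply: bip_sym.
apply: (@within_leq _ _ (l2 + l1)); first lia.
by apply: within_cat W2 W1.
Qed.

Definition degl E u := #|[pred w | (u, w) \in E]|.
Definition degr E w := #|[pred u | (u, w) \in E]|.

Lemma card_degl E : #|E| = \sum_u degl E u.
Proof.
rewrite /degl; under eq_bigr do rewrite -sum1_card big_mkcond /=.
rewrite pair_bigA -sum1_card big_mkcond /=.
by apply: eq_bigr => -[u w].
Qed.

Lemma card_degr E : #|E| = \sum_w degr E w.
Proof.
rewrite /degr; under eq_bigr do rewrite -sum1_card big_mkcond /=.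
rewrite exchange_big pair_bigA -sum1_card big_mkcond /=.
by apply: eq_bigr => -[u w].
Qed.

Lemma card_bip d E p :
  (forall u, degl E u <= d) -> (forall w, degr E w <= d) -> #|bip E p| <= d.
Proof.
move=> dl dr; case: p => [u|w].
  rewrite (leq_trans _ (dl u)) // /degl.
  rewrite -(fintype.card_image (@inr_inj 'I_n 'I_n) [pred w | (u, w) \in E]).
  apply/subset_leq_card/fintype.subsetP=> -[//|w] uw.
  by apply/fintype.imageP; exists w.
rewrite (leq_trans _ (dr w)) // /degr.
rewrite -(fintype.card_image (@inl_inj 'I_n 'I_n) [pred u | (u, w) \in E]).
apply/subset_leq_card/fintype.subsetP=> -[u|//] uw.
by apply/fintype.imageP; exists u.
Qed.

Lemma degl_insert E u w u' : degl ((u, w) |: E) u' <= (u' == u) + degl E u'.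
Proof.
rewrite /degl; have [->|neq_u] := eqVneq u' u.
  apply: (leq_trans (n := #|predU1 w [pred v | (u, v) \in E]|)).
    apply/subset_leq_card/fintype.subsetP=> v; rewrite !inE.
    by case/predU1P=> [[->]|->]; rewrite ?eqxx ?orbT.
  by rewrite cardU1 leq_add2r leq_b1.
apply/subset_leq_card/fintype.subsetP=> v; rewrite !inE xpair_eqE.
by rewrite (negPf neq_u).
Qed.

Lemma degr_insert E u w w' : degr ((u, w) |: E) w' <= (w' == w) + degr E w'.
Proof.
rewrite /degr; have [->|neq_w] := eqVneq w' w.
  apply: (leq_trans (n := #|predU1 u [pred v | (v, w) \in E]|)).
    apply/subset_leq_card/fintype.subsetP=> v; rewrite !inE.
    by case/predU1P=> [[->]|->]; rewrite ?eqxx ?orbT.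
  by rewrite cardU1 leq_add2r leq_b1.
apply/subset_leq_card/fintype.subsetP=> v; rewrite !inE xpair_eqE.
by rewrite (negPf neq_w) andbF.
Qed.

(** Take [E] maximal among the separating graphs with degrees at most [d].  By
    maximality, every left vertex of degree less than [d] is within [k.+1] steps
    of every right vertex of degree less than [d].  As a ball contains few
    vertices, almost all vertices on one of the two sides have degree [d]. *)
Lemma dense_separating k d : exists2 E : {set 'I_n * 'I_n},
  separating k E & d * (n - d.+1 ^ k.+1) <= #|E|.
Proof.
pose P E := [&& separating k E, [forall u, degl E u <= d] & [forall w, degr E w <= d]].
have P0 : P finset.set0.
  rewrite /P separating0 /=; apply/andP; split; apply/forallP=> v.
    by rewrite /degl eq_card0 // => w; rewrite !inE.
  by rewrite /degr eq_card0 // => w; rewrite !inE.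
have [E /maxsetP[/and3P[sepE /forallP dl /forallP dr] maxE] _] := maxset_exists P0.
exists E => //.
have close u w : degl E u < d -> degr E w < d -> within (bip E) k.+1 (inl u) (inr w).
  move=> ul wl; have [uwE|uwE] := boolP ((u, w) \in E).
    by apply: (@within_leq _ _ 1) => //; apply: within1.
  apply: (@within_leq _ _ k) => //; apply: contraNT uwE => far.
  rewrite -(maxE ((u, w) |: E)) ?finset.setU11 ?finset.subsetUr //.
  rewrite /P separating_insert //=; apply/andP; split; apply/forallP=> v.
    apply: leq_trans (degl_insert _ _ _ _) _.
    by have [->|_] := eqVneq v u; rewrite // add0n.
  apply: leq_trans (degr_insert _ _ _ _) _.
  by have [->|_] := eqVneq v w; rewrite // add0n.
have [u /= ul|fullu] := pickP [pred u | degl E u < d]; last first.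
  rewrite card_degl (eq_bigr (fun=> d)) => [|u _]; last first.
    by apply/eqP; rewrite eqn_leq dl leqNgt; have /= -> := fullu u.
  by rewrite sum_nat_const card_ord mulnC leq_mul2r leq_subr orbT.
have few : #|[pred w | degr E w < d]| <= d.+1 ^ k.+1.
  apply: leq_trans (card_within k.+1 (inl u) (fun p => card_bip p dl dr)).
  rewrite -(fintype.card_image (@inr_inj 'I_n 'I_n) [pred w | degr E w < d]).
  by apply/subset_leq_card/fintype.subsetP=> p /fintype.imageP[w wl ->]; apply: close.
rewrite card_degr (bigID [pred w | degr E w < d]) /=.
apply: leq_trans (leq_addl _ _).
rewrite (eq_bigr (fun=> d)) => [|w]; last first.
  by rewrite -leqNgt => wd; apply/eqP; rewrite eqn_leq dr.
rewrite sum_nat_const mulnC leq_mul2r; apply/orP; right.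
rewrite leq_subLR (leq_trans _ (leq_add few (leqnn _))) //.
rewrite -{1}(card_ord n) -(cardC [pred w | degr E w < d]) leq_add2l.
by apply/subset_leq_card/fintype.subsetP.
Qed.
End Lifts.

(** * The truncated graph metric *)

Section TruncatedDistance.
Variables (T : finType) (e : rel T) (g : nat).

(** The graph distance truncated at [g]: [find] returns [g] when there is no
    walk of length less than [g]. *)
Definition tdist x y := find (fun l => within e l x y) (iota 0 g).

Lemma tdist_le_trunc x y : tdist x y <= g.
Proof. by apply: leq_trans (find_size _ _) _; rewrite size_iota. Qed.

Lemma tdist_leq l x y : within e l x y -> tdist x y <= l.
Proof.
move=> xy; rewrite leqNgt; apply/negP => lt_l.
have := before_find 0 lt_l; rewrite nth_iota ?add0n ?xy //.
exact: leq_trans lt_l (tdist_le_trunc x y).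
Qed.

Lemma within_tdist x y : tdist x y < g -> within e (tdist x y) x y.
Proof.
move=> lt_g; have /(nth_find 0) : has (fun l => within e l x y) (iota 0 g).
  by rewrite has_find size_iota.
by rewrite nth_iota.
Qed.

Lemma tdist_far k x y : g = k.+1 -> ~~ within e k x y -> tdist x y = g.
Proof.
move=> gk far; apply/eqP; rewrite eqn_leq tdist_le_trunc leqNgt.
apply: contra far => lt_g; apply: within_leq (within_tdist lt_g).
by rewrite -ltnS -gk.
Qed.

Lemma tdistxx x : tdist x x = 0.
Proof. by apply/eqP; rewrite -leqn0 tdist_leq //= eqxx. Qed.

Lemma tdist_sym x y : symmetric e -> tdist x y = tdist y x.
Proof. by move=> es; apply: eq_find => l; apply: within_sym. Qed.

Lemma tdist_triangle y x z : tdist x z <= tdist x y + tdist y z.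
Proof.
have [ltxy|] := ltnP (tdist x y) g; last by have := tdist_le_trunc x z; lia.
have [ltyz|] := ltnP (tdist y z) g; last by have := tdist_le_trunc x z; lia.
by apply: tdist_leq; apply: within_cat; apply: within_tdist.
Qed.

Lemma tdist_eq0 x y : 0 < g -> tdist x y = 0 -> x = y.
Proof.
move=> g0 xy0; have := @within_tdist x y; rewrite xy0 => /(_ g0).
by move/eqP.
Qed.

End TruncatedDistance.

Local Open Scope ring_scope.

(** A copy of [T] that carries the parameters of its metric. *)
Definition graph_space (R : realType) (T : finType) (e : rel T)
    (k : nat) (s : R) (e_sym : symmetric e) (s_gt0 : 0 < s) : Type := T.

Section GraphSpace.
Variables (R : realType) (T : finType) (e : rel T) (k : nat) (s : R).
Variables (e_sym : symmetric e) (s_gt0 : 0 < s).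
Local Notation M := (graph_space k e_sym s_gt0).

HB.instance Definition _ := Choice.on M.

Definition graph_dist (x y : M) : R := (tdist e k.+1 x y)%:R * s.

Let graph_distxx x : graph_dist x x = 0.
Proof. by rewrite /graph_dist tdistxx mul0r. Qed.

Let graph_dist_eq0 x y : graph_dist x y = 0 -> x = y.
Proof.
move/eqP; rewrite mulf_eq0 (gt_eqF s_gt0) orbF pnatr_eq0 => /eqP.
exact: tdist_eq0.
Qed.

Let graph_dist_sym x y : graph_dist x y = graph_dist y x.
Proof. by rewrite /graph_dist tdist_sym. Qed.

Let graph_dist_triangle y x z : graph_dist x z <= graph_dist x y + graph_dist y z.
Proof.
by rewrite -mulrDl ler_pM2r // -natrD ler_nat tdist_triangle.
Qed.

HB.instance Definition _ := isMetric.Build R M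
  graph_distxx graph_dist_eq0 graph_dist_sym graph_dist_triangle.

Lemma mdist_graph (x y : M) : mdist x y = (tdist e k.+1 x y)%:R * s.
Proof. by []. Qed.

End GraphSpace.

Lemma card_setT_finType (T : finType) :
  ([set: T] #= `I_#|T|)%classic%card.
Proof.
apply/card_set_bijP; exists (fun x : T => nat_of_ord (enum_rank x)); split.
- by move=> x _ /=; apply: ltn_ord.
- by move=> x y _ _ /ord_inj /enum_rank_inj.
- move=> i /= lti; exists (enum_val (Ordinal lti)) => //=.
  by rewrite enum_valK.
Qed.

(** * Norming functionals *)

Local Open Scope classical_set_scope.
Local Open Scope ring_scope.

Section Sublinear.
Variables (R : realType) (V : lmodType R).
Implicit Types (p q : V -> R) (u v w x y : V).

Definition sublinear p :=
  (forall x y, p (x + y) <= p x + p y) /\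
  (forall a x, 0 <= a -> p (a *: x) = a * p x).

(** A sublinear function is linear along [w] exactly when it is odd at [w]. *)
Definition odd_at p w := p (- w) = - p w.

Lemma sublinear0 p : sublinear p -> p 0 = 0.
Proof. by case=> _ pZ; rewrite -(scale0r 0) pZ // mul0r. Qed.

Lemma sublinear_opp_ge p x : sublinear p -> - p (- x) <= p x.
Proof.
move=> sp; have [pD _] := sp.
by rewrite lerNl -subr_ge0 opprK -(sublinear0 sp) -(addNr x) pD.
Qed.

Lemma sublinear_addZ p w a x :
  sublinear p -> odd_at p w -> p (x + a *: w) = p x + a * p w.
Proof.
move=> [pD pZ] pw.
have pos v b : odd_at p v -> 0 <= b -> p (x + b *: v) = p x + b * p v.
  move=> pv b0; apply/eqP; rewrite eq_le -{1}pZ // pD /=.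
  have := pD (x + b *: v) (b *: - v).
  by rewrite scalerN addrK -scalerN pZ // pv mulrN lerBrDr.
have [/pos->//|/ltW a0] := leP 0 a.
have := pos (- w) (- a); rewrite /odd_at scalerN scaleNr !opprK pw opprK.
by rewrite mulrNN; apply; rewrite ?oppr_ge0.
Qed.

Lemma sublinear_sum p m (a : 'I_m -> R) (w : 'I_m -> V) :
    sublinear p -> (forall i, odd_at p (w i)) ->
  p (\sum_(i < m) a i *: w i) = \sum_(i < m) a i * p (w i).
Proof.
move=> sp pw; elim: m a w pw => [|m IH] a w pw.
  by rewrite !big_ord0 sublinear0.
by rewrite !big_ord_recr /= sublinear_addZ // IH.
Qed.

(** Oddness of [p] at [w] leaves no room below [p w]: sublinearity puts [q w]
    between [- p (- w)] and [p w], which are equal.  Hence the steps that make a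
    function odd at one vector after another do not interfere. *)
Lemma odd_at_le p q w :
  sublinear q -> (forall x, q x <= p x) -> odd_at p w -> odd_at q w /\ q w = p w.
Proof.
move=> sq qp pw; have := qp w; have := qp (- w); rewrite /odd_at pw.
by have := sublinear_opp_ge w sq => ? ? ?; split; lra.
Qed.

(** For a sublinear [p], this is the largest sublinear function below [p] that
    takes the value [- p v] at [- v]. *)
Definition straighten p v x :=
  inf [set p (x + t *: v) - t * p v | t in [set t : R | 0 <= t]].

Lemma straighten_le p v t x :
  sublinear p -> 0 <= t -> straighten p v x <= p (x + t *: v) - t * p v.
Proof.
move=> sp t0; have [pD pZ] := sp; apply: ge_inf; last by exists t.
exists (- p (- x)) => _ [r /= r0 <-].
rewrite -pZ // lerBrDr addrC lerBlDr.
by rewrite (le_trans _ (pD _ _)) // addrAC subrr add0r.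
Qed.

Lemma le_straighten p v x c :
  (forall t, 0 <= t -> c <= p (x + t *: v) - t * p v) -> c <= straighten p v x.
Proof.
move=> cle; apply: lb_le_inf; last by move=> _ [t /= t0 <-]; apply: cle.
by exists (p (x + 0 *: v) - 0 * p v); exists 0 => /=.
Qed.

Lemma straighten_sublinear p v : sublinear p -> sublinear (straighten p v).
Proof.
move=> sp; have [pD pZ] := sp; split.
  move=> x y; rewrite -lerBlDr; apply: le_straighten => t t0.
  rewrite lerBlDr -lerBlDl; apply: le_straighten => r r0.
  rewrite lerBlDl; apply: le_trans (straighten_le v (x + y) sp (addr_ge0 t0 r0)) _.
  rewrite scalerDl addrACA mulrDl.
  by have := pD (x + t *: v) (y + r *: v); lra.
have le a x : 0 < a -> straighten p v (a *: x) <= a * straighten p v x.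
  move=> a0; rewrite -ler_pdivrMl //; apply: le_straighten => t t0.
  rewrite ler_pdivrMl //.
  apply: le_trans (straighten_le v (a *: x) sp (mulr_ge0 (ltW a0) t0)) _.
  by rewrite -scalerA -scalerDr (pZ _ _ (ltW a0)) mulrBr mulrA.
move=> a x; rewrite le_eqVlt => /predU1P[<-|a0].
  rewrite scale0r mul0r; apply/eqP; rewrite eq_le.
  have := straighten_le v 0 sp (lexx 0).
  rewrite scale0r addr0 mul0r subr0 (sublinear0 sp) => -> /=.
  by apply: le_straighten => t t0; rewrite add0r pZ // subrr.
apply/eqP; rewrite eq_le le //= -ler_pdivlMl //.
have := le a^-1 (a *: x); rewrite invr_gt0 a0 => /(_ isT).
by rewrite scalerA mulVf ?gt_eqF // scale1r.
Qed.

Lemma straighten_dom p v x : sublinear p -> straighten p v x <= p x.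
Proof.
move=> sp; have := straighten_le v x sp (lexx 0).
by rewrite scale0r mul0r addr0 subr0.
Qed.

Lemma straighten_odd p v :
  sublinear p -> odd_at (straighten p v) v /\ straighten p v v = p v.
Proof.
move=> sp; have sq := straighten_sublinear v sp.
have := straighten_le v (- v) sp ler01.
rewrite scale1r mul1r addNr (sublinear0 sp) sub0r.
have := straighten_dom v v sp; have := sublinear_opp_ge v sq.
by rewrite /odd_at => *; split; lra.
Qed.

(** Being linear along finitely many vectors is all that is asked of the
    functional, so straightening [p] along [v], then along each vector of [s],
    suffices. *)
Lemma finite_Hahn_Banach p v (s : seq V) : sublinear p ->
  exists q, [/\ sublinear q, forall x, q x <= p x, q v = p v
    & {in v :: s, forall w, odd_at q w}].
Proof.
move=> sp; elim: s => [|u s [q [sq qp qv q_odd]]].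
  have [ov ev] := straighten_odd v sp.
  exists (straighten p v); split=> // [|x|w].
  - exact: straighten_sublinear.
  - exact: straighten_dom.
  - by rewrite inE => /eqP->.
have [ou eu] := straighten_odd u sq; have sr := straighten_sublinear u sq.
have rq x := straighten_dom u x sq.
have [_ rv] := odd_at_le sr rq (q_odd v (mem_head _ _)).
exists (straighten q u); split=> // [x||w].
- exact: le_trans (rq x) (qp x).
- by rewrite rv.
- rewrite !inE orbCA => /predU1P[->//|ws].
  by have [|] := odd_at_le sr rq (q_odd w _); rewrite ?inE.
Qed.

End Sublinear.

Lemma norm_sublinear (R : realType) (V : normedModType R) :
  sublinear (fun x : V => `|x|).
Proof.
by split=> [x y|a x a0]; [apply: ler_normD | rewrite normrZ ger0_norm].
Qed.

(** * Counting the sign patterns of matrices of small rank *)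

Section BoundedFactorization.
Variable F : realFieldType.

(** The cofactors along row [l] do not see that row, hence are those of the
    identity matrix. *)
Lemma det_rowsub_replace r m (U : 'M[F]_(m, r)) (f h : 'I_r -> 'I_m) l i :
    rowsub f U = 1%:M -> h l = i -> (forall k, k != l -> h k = f k) ->
  \det (rowsub h U) = U i l.
Proof.
move=> fU hl hf.
have cof j : cofactor (rowsub h U) l j = (j == l)%:R.
  transitivity ((\adj (1%:M : 'M[F]_r)) j l); last by rewrite adj1 mxE.
  rewrite mxE -fU /cofactor; congr (_ * \det _); apply/matrixP=> a b.
  by rewrite !mxE hf // eq_sym neq_lift.
rewrite (expand_det_row _ l) (bigD1 l) //= big1 => [|j /negPf jl].
  by rewrite addr0 cof eqxx mulr1 mxE hl.
by rewrite cof jl mulr0.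
Qed.

(** Among the maximal square submatrices of a column basis of [A], choose one
    with determinant of maximal absolute value, and the same rows in [A].  By
    Cramer's rule the coefficients of the other rows on these are quotients of
    minors by the maximal one. *)
Lemma bounded_rank_factorization m n t (A : 'M[F]_(m, n)) b :
    (\rank A <= t)%N -> 0 <= b -> (forall i j, `|A i j| <= b) ->
  exists (U : 'M[F]_(m, t)) (V : 'M[F]_(t, n)),
    [/\ A = U *m V, forall i l, `|U i l| <= 1 & forall l j, `|V l j| <= b].
Proof.
(* [k] zero columns and rows pad the factors from the rank of [A] to [t]. *)
move=> /subnKC <- b0 Ab; move: (_ - _)%N => k.
set r := \rank A; pose C := col_base A.
pose f0 := fullrankfun (col_base_full A).
have f0_unit : rowsub f0 C \in unitmx by apply: fullrowsub_unit.
case: (@arg_maxP _ _ _ (f0 : {ffun 'I_r -> 'I_m}) predT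
  (fun h => `|\det (rowsub h C)|) isT) => f _ fmax.
pose D := rowsub f C.
have detD : 0 < `|\det D|.
  by rewrite (lt_le_trans _ (fmax f0 isT)) // normr_gt0 -unitfE -unitmxE.
have D_unit : D \in unitmx by rewrite unitmxE unitfE -normr_gt0.
pose U := C *m invmx D.
have CU : C = U *m D by rewrite mulmxKV.
have fU : rowsub f U = 1%:M by rewrite -mul_rowsub_mx mulmxV.
have AU : A = U *m rowsub f A.
  have -> : rowsub f A = D *m row_base A by rewrite mul_rowsub_mx mulmx_base.
  by rewrite mulmxA -CU mulmx_base.
have U1 i l : `|U i l| <= 1.
  pose h := [ffun k => if k == l then i else f k].
  have -> : U i l = \det (rowsub h U).
    rewrite (det_rowsub_replace (l := l) (i := i) fU) //; first by rewrite ffunE eqxx.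
    by move=> k' /negPf k'l; rewrite ffunE k'l.
  rewrite -(ler_pM2r detD) mul1r -normrM -det_mulmx mul_rowsub_mx -CU.
  exact: fmax.
exists (row_mx U 0), (col_mx (rowsub f A) 0); split.
- by rewrite mul_row_col mul0mx addr0.
- move=> i l; rewrite mxE; case: splitP => l' _ //.
  by rewrite mxE normr0 ler01.
- by move=> l j; rewrite mxE; case: splitP => l' _; rewrite mxE ?normr0.
Qed.

End BoundedFactorization.

Section Counting.
Variable R : archiRealFieldType.

(** The index of the cell of a point of [[-1, 1]] in a grid of step [1 / q]. *)
Definition grid (q : nat) (x : R) : 'I_(2 * q).+1 :=
  inord (Num.truncn (q%:R * (x + 1))).

Lemma grid_close q x y : `|x| <= 1 -> `|y| <= 1 -> grid q x = grid q y ->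
  q%:R * `|x - y| <= 1.
Proof.
move=> x1 y1 /(congr1 (@nat_of_ord _)); rewrite /grid.
have bound (z : R) : `|z| <= 1 -> (0 <= q%:R * (z + 1) <= (2 * q)%:R).
  rewrite ler_norml => /andP[z0 z1]; rewrite mulr_ge0 //=; last lra.
  by rewrite natrM mulrC ler_wpM2r //; lra.
have small (z : R) : `|z| <= 1 -> (Num.truncn (q%:R * (z + 1)) < (2 * q).+1)%N.
  move=> /bound /andP[z0 z1]; rewrite ltnS -(ler_nat R).
  by rewrite (le_trans _ z1) // truncn_le.
rewrite !inordK ?small // => xy.
have /andP[x0 _] := bound x x1; have /andP[y0 _] := bound y y1.
have /andP[] := truncn_itv x0; have /andP[] := truncn_itv y0.
rewrite xy -natr1 => *.
rewrite -(ger0_norm (ler0n R q)) -normrM ler_norml mulrBr; lra.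
Qed.

Lemma product_close t q (U U' : 'I_t -> R) (V V' : 'I_t -> R) :
    (forall l, `|U' l| <= 1) -> (forall l, `|V l| <= 1) ->
    (forall l, q%:R * `|U l - U' l| <= 1) ->
    (forall l, q%:R * `|V l - V' l| <= 1) ->
  q%:R * `|\sum_l U l * V l - \sum_l U' l * V' l| <= (2 * t)%:R.
Proof.
move=> U1 V1 dU dV; rewrite -sumrB.
apply: le_trans (ler_wpM2l (ler0n _ _) (ler_norm_sum _ _ _)) _.
rewrite mulr_sumr (_ : (2 * t)%:R = \sum_(l < t) (2 : R)); last first.
  by rewrite sumr_const card_ord natrM mulr_natr.
apply: ler_sum => l _.
have -> : U l * V l - U' l * V' l = (U l - U' l) * V l + U' l * (V l - V' l) by ring.
apply: le_trans (ler_wpM2l (ler0n _ _) (ler_normD _ _)) _.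
rewrite mulrDr !normrM mulrA [_ * (`|U' l| * _)]mulrCA.
have := dU l; have := dV l; have := U1 l; have := V1 l.
have : 0 <= q%:R * `|U l - U' l| by rewrite mulr_ge0.
have : 0 <= q%:R * `|V l - V' l| by rewrite mulr_ge0.
have := normr_ge0 (U' l); have := normr_ge0 (V l).
by nra.
Qed.

(** If every subset of [E] were the sign pattern of a matrix of rank at most
    [t], then two of them would have the same rounded factors.  Their entries
    would then differ by at most [2 * t / q], less than the [2 * delta] needed
    for opposite signs. *)
Lemma unrealizable_pattern n t q (delta : R) (E : {set 'I_n * 'I_n}) :
    t%:R < delta * q%:R -> ((2 * q).+1 ^ (2 * (n * t)) < 2 ^ #|E|)%N ->
  exists S : {set 'I_n * 'I_n}, forall A : 'M[R]_n,
    (forall i j, `|A i j| <= 1) ->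
    (forall i j : 'I_n, (i, j) \in E ->
       if (i, j) \in S then delta <= A i j else A i j <= - delta) ->
  (t < \rank A)%N.
Proof.
move=> delta_q few; apply: contrapT => no_S.
have fact (S : {set 'I_n * 'I_n}) : exists UV : 'M[R]_(n, t) * 'M[R]_(t, n),
    [/\ forall i l, `|UV.1 i l| <= 1, forall l j, `|UV.2 l j| <= 1 &
      forall i j : 'I_n, (i, j) \in E ->
        if (i, j) \in S then delta <= (UV.1 *m UV.2) i j
        else (UV.1 *m UV.2) i j <= - delta].
  apply: contrapT => noUV; apply: no_S; exists S => A A1 AS.
  rewrite ltnNge; apply/negP => rA.
  have [U [V [AUV U1 V1]]] := bounded_rank_factorization rA ler01 A1.
  by apply: noUV; exists (U, V); split; rewrite //= -AUV.
have [UV UVP] := choice fact.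
pose code S := (map_mx (grid q) (UV S).1, map_mx (grid q) (UV S).2).
suff inj : {in powerset E &, injective code}.
  have := max_card (mem (imset code (mem (powerset E)))).
  rewrite (card_in_imset inj).
  rewrite card_powerset card_prod !card_mx card_ord.
  by rewrite (mulnC t n) -expnD addnn -mul2n leqNgt few.
move=> S S'; rewrite !powersetE => SE SE' [cU cV].
apply/finset.setP => -[i j].
have [ijE|ijE] := boolP ((i, j) \in E); last first.
  have out (T : {set 'I_n * 'I_n}) (TE : T \subset E) :=
    contraNF (fintype.subsetP TE (i, j)) ijE.
  by rewrite !out.
have [U1 V1 P] := UVP S; have [U1' V1' P'] := UVP S'.
have : q%:R * `|((UV S).1 *m (UV S).2) i j - ((UV S').1 *m (UV S').2) i j|
    <= (2 * t)%:R.
  rewrite !mxE; apply: product_close => // l; apply: grid_close => //.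
    by have /matrixP/(_ i l) := cU; rewrite !mxE.
  by have /matrixP/(_ l j) := cV; rewrite !mxE.
have := P i j ijE; have := P' i j ijE.
rewrite natrM.
set x' := (_ *m _) i j; set x := (_ *m _) i j => hx' hx xx'.
have far : ~ 2 * delta <= `|x - x'|.
  move=> /(ler_wpM2l (ler0n R q)) h; move: (le_trans h xx').
  by rewrite mulrCA ler_pM2l // mulrC leNgt delta_q.
case: (_ \in S) hx => hx; case: (_ \in S') hx' => hx' //; exfalso; apply: far.
  by rewrite ler_normr; apply/orP; left; lra.
by rewrite ler_normr; apply/orP; right; lra.
Qed.
End Counting.

(** * From an embedding to a matrix of small rank *)

Section Separation.
Variable R : realType.

(** A linear relation between the vectors gives the same relation between the
    rows of the matrix. *)
Lemma ldim_ge_rank (V : lmodType R) m n (v : 'I_m -> V) (p : 'I_n -> V -> R) :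
    (forall j, sublinear (p j)) -> (forall i j, odd_at (p j) (v i)) ->
  (((\rank (\matrix_(i, j) p j (v i)))%:R)%:E <= ldim V)%E.
Proof.
move=> sp pv; set B := \matrix_(i, j) _.
apply: ereal_sup_ubound; exists (\rank B) => //=.
exists (fun l => v (maxrankfun B l)) => a av0.
have free := maxrowsub_free B.
suff /rowP a0 : \row_l a l = 0 by move=> l; have := a0 l; rewrite !mxE.
apply: (row_free_inj free); rewrite mul0mx; apply/rowP=> j; rewrite !mxE.
transitivity (p j (\sum_(l < \rank B) a l *: v (maxrankfun B l))).
  rewrite (sublinear_sum _ (sp j)) => [|l]; last exact: pv.
  by apply: eq_bigr => l _; rewrite !mxE.
by rewrite av0 sublinear0.
Qed.

Lemma sublinear_lip (X : normedModType R) (q : X -> R) x y :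
  sublinear q -> (forall z, q z <= `|z|) -> q x - q y <= `|x - y|.
Proof.
move=> [qD _] q1; rewrite lerBlDl (le_trans _ (lerD (lexx _) (q1 _))) //.
by rewrite (le_trans _ (qD _ _)) // addrC subrK.
Qed.

(** The entries are [q_j (x_i) - m_j], divided by [rho], where [q_j] norms
    [y_j - z_j] and [m_j] is the midpoint of [q_j (y_j)] and [q_j (z_j)].
    Subtracting the midpoints raises the rank by at most one. *)
Lemma sign_matrix (X : normedModType R) n (x y z : 'I_n -> X) (rho delta : R)
    (E S : {set 'I_n * 'I_n}) :
    0 < rho ->
    (forall i j, `|x i - y j| <= rho) -> (forall i j, `|x i - z j| <= rho) ->
    (forall i j : 'I_n, (i, j) \in E ->
       2 * `|x i - (if (i, j) \in S then y j else z j)| + 2 * (rho * delta)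
         <= `|y j - z j|) ->
  exists A : 'M[R]_n,
    [/\ forall i j, `|A i j| <= 1,
        forall i j : 'I_n, (i, j) \in E ->
          if (i, j) \in S then delta <= A i j else A i j <= - delta
      & forall t, (t < \rank A)%N -> (t%:R%:E <= ldim X)%E].
Proof.
move=> rho0 xy xz sep.
have fact j : exists q : X -> R, [/\ sublinear q, forall w, q w <= `|w|,
    q (y j - z j) = `|y j - z j|, odd_at q (y j - z j) & forall i, odd_at q (x i)].
  have [q [sq q1 qv q_odd]] :=
    finite_Hahn_Banach (y j - z j) [seq x i | i : 'I_n] (norm_sublinear X).
  exists q; split=> // [|i]; apply: q_odd; first exact: mem_head.
  by rewrite inE map_f ?orbT // mem_enum.
have [q qP] := choice fact.
pose m j := (q j (y j) + q j (z j)) / 2.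
pose B := \matrix_(i, j) q j (x i).
pose J : 'cV[R]_n := const_mx 1; pose mrow := \row_j m j.
pose A := rho^-1 *: (B - J *m mrow).
have AE i j : A i j = rho^-1 * (q j (x i) - m j).
  by rewrite !mxE big_ord1 !mxE mul1r.
have lip j a b : q j a - q j b <= `|a - b|.
  by have [sq q1 _ _ _] := qP j; apply: sublinear_lip.
have qyz j : q j (y j) - q j (z j) = `|y j - z j|.
  have [sq _ qv q_odd _] := qP j.
  have := sublinear_addZ 1 (z j) sq q_odd.
  by rewrite scale1r mul1r qv addrC subrK => ->; rewrite addrAC subrr add0r.
exists A; split.
- move=> i j; rewrite AE normrM gtr0_norm ?invr_gt0 // ler_pdivrMl // mulr1.
  have := lip j (x i) (y j); have := lip j (y j) (x i).
  have := lip j (x i) (z j); have := lip j (z j) (x i).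
  rewrite ![`|_ - x i|]distrC; have := xy i j; have := xz i j.
  by rewrite ler_norml /m => *; apply/andP; split; lra.
- move=> i j ijE; have := sep i j ijE; have := qyz j; rewrite !AE.
  case: ifP => _ qj.
    rewrite ler_pdivlMl //; have := lip j (y j) (x i).
    by rewrite [`|_ - x i|]distrC /m; lra.
  rewrite ler_pdivrMl // mulrN; have := lip j (x i) (z j).
  by rewrite /m; lra.
- move=> t tA; apply: le_trans (ldim_ge_rank (v := x) (p := q) _ _); last 2 first.
  + by move=> j; have [] := qP j.
  + by move=> i j; have [] := qP j.
  rewrite -/B lee_fin ler_nat -ltnS (leq_trans tA) // -addn1.
  apply: leq_trans (mxrankS (scalemx_sub _ (submx_refl _))) _.
  apply: leq_trans (mxrank_add _ _) _; rewrite leq_add2l mxrank_opp.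
  exact: leq_trans (mxrankM_maxl _ _) (rank_leq_col _).
Qed.
End Separation.

(** * The dimension bound *)

Lemma sqr_leq_exp2 t : (5 <= t)%N -> (t * t <= 2 ^ t)%N.
Proof.
elim: t => // t IH; rewrite leq_eqVlt => /predU1P[<-//|].
by rewrite ltnS expnS => t5; have := IH t5; nia.
Qed.

Section Main.
Variable R : realType.
Variables omega Omega : R -> R.
Hypothesis Omega_ge0 : nonneg_fun Omega.
Hypothesis Omega_incr : increasing_on_nonneg Omega.
Hypothesis omega_le : forall s : R, 0 <= s -> omega s <= Omega s.
Hypothesis omega_oo : omega s @[s --> +oo] --> +oo.

Lemma gen_inv_ub (T u : R) : 0 <= u -> omega u <= T -> u <= gen_inv omega T.
Proof.
move=> u0 uT; apply: ub_le_sup => //.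
move/cvgryPgt/(_ T) : omega_oo => -[B [_ HB]].
exists B => v /= [v0 vT]; rewrite leNgt; apply/negP => /HB.
by rewrite ltNge vT.
Qed.

Lemma gen_inv_ge s : 0 < s -> s <= gen_inv omega (2 * Omega s).
Proof.
move=> s0; apply: gen_inv_ub; first exact: ltW.
by have := omega_le (ltW s0); have := Omega_ge0 (ltW s0); lra.
Qed.

(** A scale [s] whose ratio exceeds [beta / 2] has
    [gen_inv omega (2 * Omega s) < 2 * s / beta], so that any integer
    [g > 2 / beta] works; since [beta <= 1], there is one with
    [g <= 3 / beta]. *)
Lemma beta_witness : 0 < beta omega Omega <= 1 /\
  exists (s : R) (k : nat), [/\ 0 < s, k.+1%:R * beta omega Omega <= 3
    & 2 * Omega s < omega (k.+1%:R * s)].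
Proof.
set ratios := [set s / gen_inv omega (2 * Omega s) | s in [set s | 0 < s]].
have ratio_le1 r : ratios r -> r <= 1.
  move=> [s /= s0 <-]; have s_le := gen_inv_ge s0.
  by rewrite ler_pdivrMr ?mul1r // (lt_le_trans s0).
have ratio1 : ratios (1 / gen_inv omega (2 * Omega 1)) by exists 1 => /=.
have b0 : 0 < beta omega Omega.
  apply: (@lt_le_trans _ _ (1 / gen_inv omega (2 * Omega 1))).
    by rewrite div1r invr_gt0 (lt_le_trans _ (gen_inv_ge ltr01)).
  by apply: ub_le_sup => //; exists 1.
have b1 : beta omega Omega <= 1.
  by apply: ge_sup => //; exists (1 / gen_inv omega (2 * Omega 1)).
split; first by rewrite b0.
have : beta omega Omega / 2 < sup ratios.
  by rewrite ltr_pdivrMr //; rewrite /beta -/ratios in b0 *; lra.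
move/sup_gt => -[|_ [s /= s0 <-]]; first by exists (1 / gen_inv omega (2 * Omega 1)).
set b := beta _ _ in b0 b1 *; set u := gen_inv _ _ => bs.
have u0 : 0 < u by rewrite (lt_le_trans s0) // gen_inv_ge.
exists s, (Num.truncn (2 / b)); split=> //.
  have : (Num.truncn (2 / b))%:R <= 2 / b by rewrite truncn_le divr_ge0 ?ltW.
  by rewrite ler_pdivlMr // -[X in X * b <= 3]natr1 mulrDl mul1r; lra.
set g : R := (Num.truncn (2 / b)).+1%:R; have gb : 2 < g * b.
  by rewrite -ltr_pdivrMr // /g truncnS_gt.
have gs0 : 0 <= g * s by apply: mulr_ge0 (ler0n _ _) (ltW s0).
rewrite ltNge; apply/negP => /(gen_inv_ub gs0).
rewrite -/u leNgt => /negP; apply.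
have : b / 2 * u < s by rewrite -ltr_pdivlMr.
by nra.
Qed.

(** A ball of radius [k.+1] in the graph of [dense_separating] has at most
    [b = d.+1 ^ k.+1] points; with the degree [d = 4 * t ^ 2 + 1] and
    [n = 2 * b], the graph has at least [d * b > 2 * n * t ^ 2] edges.  The threshold on [t] absorbs the margin
    [delta], which depends on [omega] and [Omega] but not on [n]. *)
Lemma dim_lower_bound (s : R) (k : nat) :
    0 < s -> 2 * Omega s < omega (k.+1%:R * s) ->
  exists T : nat, forall t n : nat, (T <= t)%N ->
    n = (2 * (4 * t ^ 2 + 2) ^ k.+1)%N ->
  exists M : metricType R, ([set: M] #= `I_(3 * n))%card /\
    forall X : normedModType R,
      (exists f : M -> X, forall x y : M,
        omega (mdist x y) <= `|f x - f y| <= Omega (mdist x y)) ->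
      (t%:R%:E <= ldim X)%E.
Proof.
move=> s0 gap; pose g : R := k.+1%:R * s; pose rho := Omega g.
have g0 : 0 <= g by rewrite mulr_ge0 // ltW.
have rho0 : 0 < rho.
  rewrite (lt_le_trans _ (omega_le g0)) // (le_lt_trans _ gap) //.
  by rewrite mulr_ge0 // Omega_ge0 // ltW.
pose delta := (omega g / 2 - Omega s) / rho.
have delta0 : 0 < delta by apply: divr_gt0 => //; rewrite -/g in gap; lra.
pose Q := (Num.truncn delta^-1).+1.
have deltaQ : 1 < delta * Q%:R by rewrite -ltr_pdivrMl // mulr1 truncnS_gt.
(* The grid step [1 / (t * Q)] resolves the margin, and this threshold
   makes the number of its cells at most [2 ^ t]. *)
exists (2 * Q + 5)%N => t n tQ nE.
have t0 : (0 < t)%N by lia.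
pose d := (4 * t ^ 2 + 1)%N.
have [E sepE cardE] := dense_separating n k d.
have dE : d.+1 = (4 * t ^ 2 + 2)%N by rewrite /d; lia.
rewrite dE in cardE.
set b := (_ ^ k.+1)%N in nE cardE.
have nb : (n - b = b)%N by lia.
rewrite nb in cardE.
have b0 : (0 < b)%N by rewrite expn_gt0; lia.
have [||S SP] := @unrealizable_pattern R n t (t * Q) delta E.
- by rewrite natrM mulrCA ltr_pMr // ltr0n.
- have step : ((2 * (t * Q)).+1 <= 2 ^ t)%N.
    have : (t * t <= 2 ^ t)%N by apply: sqr_leq_exp2; lia.
    by nia.
  apply: (@leq_ltn_trans ((2 ^ t) ^ (2 * (n * t)))).
    by rewrite leq_exp2r // nE; nia.
  by rewrite -expnM ltn_exp2l // (leq_trans _ cardE) // nE /d; nia.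
pose M := graph_space k (@lift2_sym n E S) s0 : metricType R.
exists M; split.
  have <- : #|{: 'I_n + 'I_n * bool}| = (3 * n)%N.
    by rewrite card_sum card_prod card_bool card_ord; lia.
  exact: card_setT_finType.
move=> X [f fP].
pose x i := f (inl i : M); pose y i := f (inr (i, true) : M).
pose z i := f (inr (i, false) : M).
have short (p q : M) l : within (lift2 E S) l p q -> `|f p - f q| <= Omega (l%:R * s).
  move=> pq; have /andP[_ /le_trans] := fP p q; apply.
  rewrite mdist_graph; apply: Omega_incr; first by rewrite mulr_ge0 // ltW.
  by rewrite ler_pM2r // ler_nat tdist_leq.
have bounded (p q : M) : `|f p - f q| <= rho.
  have /andP[_ /le_trans] := fP p q; apply.
  rewrite mdist_graph; apply: Omega_incr; first by rewrite mulr_ge0 // ltW.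
  by rewrite ler_pM2r // ler_nat tdist_le_trunc.
have [||| |A [A1 AS Adim]] := @sign_matrix R X n x y z rho delta E S => //.
- by move=> i j; apply: bounded.
- by move=> i j; apply: bounded.
- move=> i j ijE.
  have far : omega g <= `|y j - z j|.
    have /andP[+ _] := fP (inr (j, true)) (inr (j, false)).
    by rewrite mdist_graph (tdist_far (k := k)) //; move/separatingP: sepE; apply.
  have adj : `|x i - (if (i, j) \in S then y j else z j)| <= Omega s.
    have -> : (if (i, j) \in S then y j else z j) = f (inr (j, (i, j) \in S)).
      by case: ifP.
    have edge : lift2 E S (inl i) (inr (j, (i, j) \in S)) by rewrite /= ijE eqxx.
    have := short (inl i) (inr (j, (i, j) \in S)) 1%N (within1 edge).
    by rewrite mul1r.
  have -> : rho * delta = omega g / 2 - Omega s.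
    by rewrite mulrCA divff ?mulr1 // gt_eqF.
  by apply: le_trans far; lra.
exact/Adim/SP.
Qed.
End Main.

Theorem theorem17 (R : realType) :
  exists c c' : R, 0 < c /\ 0 < c' /\
  forall omega Omega : R -> R,
    nonneg_fun omega -> nonneg_fun Omega ->
    increasing_on_nonneg omega -> increasing_on_nonneg Omega ->
    (forall s : R, 0 <= s -> omega s <= Omega s) ->
    omega s @[s --> +oo] --> +oo ->
    forall N : nat, exists n : nat, (N <= n)%N /\
    exists M : metricType R, ([set: M] #= `I_(3 * n))%card /\
    forall X : normedModType R,
      (exists f : M -> X, forall x y : M,
        omega (mdist x y) <= `|f x - f y| <= Omega (mdist x y)) ->
      ((c' * n%:R `^ (c * beta omega Omega))%:E <= ldim X)%E.
Proof.
exists 12^-1, 1; split; first by rewrite invr_gt0. split; first exact: ltr01.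
move=> omega Omega _ Omega0 _ OmegaI omega_le omega_oo N.
have [/andP[b0 b1] [s [k [s0 kb gap]]]] := beta_witness Omega0 omega_le omega_oo.
have [T HT] := dim_lower_bound Omega0 OmegaI omega_le s0 gap.
pose t := (T + N + 5)%N.
pose a := (4 * t ^ 2 + 2)%N; pose n := (2 * a ^ k.+1)%N.
have tT : (T <= t)%N by rewrite /t; lia.
have [M [cM HM]] := HT t n tT erefl.
have a1 : (1 < a)%N by rewrite /a; lia.
exists n; split.
  have : (a <= a ^ k.+1)%N by rewrite expnS leq_pmulr // expn_gt0 ltnW.
  by rewrite /n /a /t; nia.
exists M; split=> // X /HM; apply: le_trans; rewrite lee_fin mul1r.
(* [n <= t ^ (4 * g)] and [g * beta <= 3] explain the exponent [beta / 12]. *)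
have n_le : (n <= t ^ (4 * k.+1))%N.
  apply: (@leq_trans ((2 * a) ^ k.+1)).
    by rewrite expnMn; apply: leq_mul => //; rewrite expnS leq_pmulr // expn_gt0.
  by rewrite expnM leq_exp2r // /a /t !expnS expn0; nia.
have e0 : 0 <= 12^-1 * beta omega Omega by rewrite mulr_ge0 ?invr_ge0 ?ltW.
have t1 : 1 <= t%:R :> R by rewrite ler1n /t; lia.
apply: (@le_trans _ _ ((t ^ (4 * k.+1))%:R `^ (12^-1 * beta omega Omega))).
  by apply: ge0_ler_powR => //; rewrite ?nnegrE ?ler0n // ler_nat.
rewrite natrX -powR_mulrn // -powRrM -[leRHS]powRr1 // ler_powR //.
by rewrite natrM; lra.
Qed.
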